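(* Let $G$ be a group (not necessarily finite), let $n$ be a positive integer, and let $k_1,\dots,k_n\in\mathbb Z$. Put $m=\mathrm{LCM}(k_1,\dots,k_n)$. Then the number (cardinality of the set) of tuples $(g_1,\dots,g_n)$ of elements of $G$ such that $\langle g_1,\dots,g_n\rangle=G$ and $g_i^{k_i}=1$ for all $i$ is divisible by $\mathrm{GCD}(G'\cdot G^{m},\,m)$.
   Context: $G'=[G,G]$ is the commutator subgroup of $G$, and $G^m$ is the subgroup of $G$ generated by $\{g^m\mid g\in G\}$; $\langle g_1,\dots,g_n\rangle$ is the subgroup generated by $g_1,\dots,g_n$. The LCM of integers is $0$ if one of them is $0$. Divisibility is understood in the sense of cardinal arithmetic: an infinite cardinal is divisible by every nonzero cardinal not exceeding it; zero is divisible by all cardinals and divides only zero. For a group $X$ and an integer $m$, $\mathrm{GCD}(X,m)$ is the least common multiple of the orders of all subgroups $H$ of $X$ such that $|H|$ divides $m$; in particular $\mathrm{GCD}(X,0)=|X|$, and $\mathrm{GCD}(X,m)=\gcd(|X|,m)$ when $X$ is finite. *)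

(* Defs.v *)
From mathcomp Require Import all_boot all_algebra.
From mathcomp Require Import boolp classical_sets functions cardinality.

Set Implicit Arguments.
Unset Strict Implicit.
Unset Printing Implicit Defensive.

Local Open Scope classical_set_scope.
Local Open Scope card_scope.

(* Cardinal arithmetic is done through sets up to equipotence, following
   mathcomp's cardinality.v: the cardinal n is `I_n, and the cardinal 0 is
   represented by any empty set. *)

(* |A| divides |B|: there is a cardinal |C| with |B| = |A| |C|. *)
Definition card_dvd (T U : Type) (A : set T) (B : set U) : Prop :=
  exists (V : Type) (C : set V), B #= A `*` C.

(* |L| is the least common multiple, for divisibility, of the cardinals of the
   members of F; it is unique up to equipotence by card_lcm_unique below. *)
Definition is_card_lcm (S T : Type) (F : set (set S)) (L : set T) : Prop :=
  (forall A, F A -> card_dvd A L) /\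
  (forall (U : Type) (M : set U),
     (forall A, F A -> card_dvd A M) -> card_dvd L M).

Definition is_subgroup (G : groupType) (H : set G) : Prop :=
  group_closed (mem H).

Definition generated (G : groupType) (A : set G) : set G :=
  smallest (@is_subgroup G) A.

Definition expgz (G : groupType) (g : G) (k : int) : G :=
  match k with
  | Posz j => (g ^+ j)%g
  | Negz j => (g ^- j.+1)%g
  end.

Definition commutator_subgroup (G : groupType) : set G :=
  generated [set [~ x, y]%g | x in [set: G] & y in [set: G]].
Arguments commutator_subgroup G : clear implicits.

Definition power_subgroup (G : groupType) (m : int) : set G :=
  generated [set expgz x m | x in [set: G]].
Arguments power_subgroup G m : clear implicits.

Definition set_mulg (G : groupType) (A B : set G) : set G :=
  [set (x * y)%g | x in A & y in B].

(* |L| = GCD(X, m) for a subgroup X of G.  When m = 0 the set `I_`|m| is empty,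
   so that the orders of all the subgroups of X divide m. *)
Definition is_GCD (G : groupType) (X : set G) (m : int)
    (T : Type) (L : set T) : Prop :=
  is_card_lcm
    [set H | [/\ is_subgroup H, H `<=` X & card_dvd H `I_(`|m|%N)]] L.

Definition lcm_tuple (n : nat) (k : n.-tuple int) : int :=
  \big[lcmz/1%R]_(i < n) tnth k i.

Lemma card_dvd_le (T U : Type) (A : set T) (B : set U) :
  B !=set0 -> card_dvd A B -> A #<= B.
Proof.
move=> [b Bb] [V [C BAC]].
have [c Cc] : exists c, C c.
  apply: contrapT => nC; have C0 : A `*` C = set0.
    by rewrite -subset0 => -[x c] /= [_ Cc]; apply: nC; exists c.
  by move: BAC; rewrite C0 card_eq0 => /eqP B0; rewrite B0 in Bb.
rewrite (card_le_eqr BAC).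
have fstA : A = fst @` (A `*` [set c]).
  apply/seteqP; split => [x Ax|_ [[y d] [/= Ay _] <-]] //.
  by exists (x, c).
have := card_image_le fst (A `*` [set c]); rewrite -fstA => /card_le_trans; apply.
by apply: subset_card_le => -[x d] /= [Ax ->].
Qed.

Lemma card_dvd0 (T U : Type) (A : set T) (B : set U) :
  card_dvd A B -> A = set0 -> B = set0.
Proof.
move=> [V [C BAC]] A0; move: BAC.
have -> : A `*` C = set0 by rewrite -subset0 A0 => -[x c] [].
by rewrite card_eq0 => /eqP.
Qed.

Lemma card_dvd_anti (T U : Type) (A : set T) (B : set U) :
  card_dvd A B -> card_dvd B A -> A #= B.
Proof.
move=> AB BA; case: (pselect (A = set0)) => [A0|nA].
  by rewrite (card_dvd0 AB A0) card_eq0 A0.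
have nB : B <> set0 by move=> /(card_dvd0 BA).
move/eqP/set0P: nA => nA; move/eqP/set0P: nB => nB.
by rewrite card_eq_le (card_dvd_le nB AB) (card_dvd_le nA BA).
Qed.

Lemma card_lcm_unique (S T U : Type) (F : set (set S))
    (L : set T) (M : set U) :
  is_card_lcm F L -> is_card_lcm F M -> L #= M.
Proof. by move=> [FL Lmin] [FM Mmin]; apply: card_dvd_anti; auto. Qed.

(* Main.v *)
From HB Require Import structures.
From mathcomp Require Import all_boot all_algebra all_fingroup all_solvable.
Require Import Defs.
From mathcomp Require Import boolp classical_sets functions cardinality.

Set Implicit Arguments.
Unset Strict Implicit.
Unset Printing Implicit Defensive.

Local Open Scope classical_set_scope.
Local Open Scope card_scope.

(** Write [X = G' G^m], and let [P <= X] be either [X] itself, if some [k_j] is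
    [0], or a finite [p]-group whose order divides some [k_j]; by Sylow's theorem
    these cases suffice. For a generating solution [g], let [D] be the largest
    subgroup of [P] that centralises the [g_i] with [i <> j] and is normalised by
    [g_j]. Multiplying [g_j] by an element of [D] gives another solution, which
    still generates [G] because [D <= X]. The group [P] permutes by conjugation the
    resulting blocks, each of [|D|] solutions, and the stabiliser in [P] of the
    block of [g] is exactly [D]. Hence the generating solutions split into classes
    of [|P : D| |D| = |P|] elements each. *)

(** * Equipotence and divisibility of cardinals, through products and partitions into blocks *)

Lemma card_eq_set_bij (T U : Type) (A : set T) (B : set U) :
  B !=set0 -> A #= B -> exists f : T -> U, set_bij A B f.
Proof.
move=> [b _] AB.
(* The point [b] makes [U] pointed, as required for extracting a total function from the
   equipotence. *)
pose pU : pointedType :=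
  HB.pack U (gen_eqMixin U) (gen_choiceMixin U) (isPointed.Build U b).
exact/(@card_set_bijP T pU).
Qed.

Lemma set_bij_card_eq (T U : Type) (A : set T) (B : set U) (f : T -> U) :
  set_bij A B f -> A #= B.
Proof. by move=> /Pbij[g _]; apply: (pcard_eq g). Qed.

Lemma card_eq_setX (T T' U U' : Type) (A : set T) (A' : set T')
    (B : set U) (B' : set U') : A #= A' -> B #= B' -> A `*` B #= A' `*` B'.
Proof.
move=> AA' BB'.
have [A'0|/eqP/set0P nA'] := pselect (A' = set0).
  by move: AA'; rewrite A'0 card_eq0 => /eqP ->; rewrite !set0X card_eq00.
have [B'0|/eqP/set0P nB'] := pselect (B' = set0).
  by move: BB'; rewrite B'0 card_eq0 => /eqP ->; rewrite !setX0 card_eq00.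
have [f [fF fI fS]] := card_eq_set_bij nA' AA'.
have [g [gF gI gS]] := card_eq_set_bij nB' BB'.
apply: (@set_bij_card_eq _ _ _ _ (fun z => (f z.1, g z.2))); split.
- by move=> [x y] [/= Ax By]; split; [apply: fF|apply: gF].
- move=> [x y] [x' y'] /set_mem[/= Ax By] /set_mem[/= Ax' By'] [].
  by move=> Ef Eg; congr (_, _); [apply: fI|apply: gI]; rewrite ?inE.
- move=> [x y] [/= /fS[x' Ax' <-] /gS[y' By' <-]].
  by exists (x', y').
Qed.

Lemma card_dvd_eql (T T' U : Type) (A : set T) (A' : set T') (M : set U) :
  A #= A' -> card_dvd A M -> card_dvd A' M.
Proof.
move=> AA' [V [C MAC]]; exists V, C; apply: card_eq_trans MAC _.
exact: card_eq_setX.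
Qed.

Lemma card_dvd_eqr (T U U' : Type) (A : set T) (M : set U) (M' : set U') :
  M #= M' -> card_dvd A M -> card_dvd A M'.
Proof.
move=> MM' [V [C MAC]]; exists V, C; apply: card_eq_trans MAC.
by rewrite card_eq_sym.
Qed.

Lemma card_dvd_trans (T U V : Type) (A : set T) (B : set U) (M : set V) :
  card_dvd A B -> card_dvd B M -> card_dvd A M.
Proof.
move=> [W [C BAC]] [W' [C' MBC']]; exists (W * W')%type, (C `*` C').
apply: card_eq_trans MBC' _.
apply: card_eq_trans (card_eq_setX BAC (card_eqxx C')) _.
apply: (@set_bij_card_eq _ _ _ _ (fun z => (z.1.1, (z.1.2, z.2)))); split.
- by move=> [[a c] c'] [[/= ? ?] ?].
- by move=> [[a c] c'] [[a1 c1] c1'] _ _ [-> -> ->].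
- by move=> [a [c c']] [/= ? [? ?]]; exists (a, c, c').
Qed.

(** Choosing a bijection from [A] onto each block identifies [M] with the product of [A] and the set
    of blocks. *)
Lemma card_dvd_partition (T U : Type) (A : set T) (M : set U)
    (P : set (set U)) :
  A !=set0 -> (forall S, P S -> A #= S) -> \bigcup_(S in P) S = M ->
  trivIset P id -> card_dvd A M.
Proof.
move=> [a Aa] PA PM tP.
(* For empty [M] the quotient 0 works; otherwise [u0] serves as default value for the chosen
   functions outside [P]. *)
have [[u0 _]|M0] := pselect (M !=set0); last first.
  exists unit, set0; rewrite setX0.
  have -> : M = set0 by apply/eqP/negP => /negP /set0P.
  exact: card_eq00.
have [f fP] : {f : set U -> T -> U & forall S, P S -> set_bij A S (f S)}.
  apply: (@choice _ _ (fun S f => P S -> set_bij A S f)) => S.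
  have [PS|nPS] := pselect (P S); last by exists (fun=> u0).
  have AS := PA S PS.
  have [|g gP] := card_eq_set_bij _ AS; last by exists g.
  apply/set0P/eqP => S0; move: AS; rewrite S0 card_eq0 => /eqP A0.
  by rewrite A0 in Aa.
exists (set U), P; rewrite card_eq_sym.
apply: (@set_bij_card_eq _ _ _ _ (fun z => f z.2 z.1)); split.
- move=> [x S] [/= Ax PS]; rewrite -PM; exists S => //.
  by have [fF _ _] := fP S PS; apply: fF.
- move=> [x S] [x' S'] /set_mem[/= Ax PS] /set_mem[/= Ax' PS'] E.
  have [fF fI _] := fP S PS; have [fF' _ _] := fP S' PS'.
  have SS' : S = S'.
    apply: tP => //; exists (f S x); split; first exact: fF.
    by rewrite E; apply: fF'.
  by subst S'; congr (_, _); apply: fI; rewrite ?inE.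
- move=> y; rewrite -PM => -[S PS Sy].
  have [_ _ /(_ y Sy)[x Ax <-]] := fP S PS.
  by exists (x, S).
Qed.

Lemma card_dvd_equiv (T U : Type) (A : set T) (M : set U)
    (R : U -> U -> Prop) :
  A !=set0 -> (forall x, M x -> R x x) ->
  (forall x y, M x -> M y -> R x y -> R y x) ->
  (forall x y z, M x -> M y -> M z -> R x y -> R y z -> R x z) ->
  (forall x, M x -> A #= [set y | M y /\ R x y]) -> card_dvd A M.
Proof.
move=> A0 Rr Rs Rt RA.
apply: (@card_dvd_partition _ _ _ _
  [set S | exists2 x, M x & S = [set y | M y /\ R x y]]) => //.
- by move=> _ [x Mx ->]; apply: RA.
- apply/seteqP; split => [y [_ [x Mx ->] []]//|y My].
  by exists [set z | M z /\ R y z]; [exists y|split => //; apply: Rr].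
- move=> _ _ [x Mx ->] [y My ->] [z [[Mz xz] [_ yz]]].
  apply/seteqP; split => t /= [Mt h]; split => //.
    by apply: (Rt y z t) => //; apply: (Rt z x t) => //; apply: Rs.
  by apply: (Rt x z t) => //; apply: (Rt z y t) => //; apply: Rs.
Qed.

(** * Divisibility by finite cardinals, and least common multiples of finite orders *)

Lemma card_setX_II (a b : nat) : `I_a `*` `I_b #= `I_(a * b).
Proof.
have [->|a_gt0] := posnP a.
  by rewrite mul0n II0 set0X card_eq00.
apply: (@set_bij_card_eq _ _ _ _ (fun z => z.1 + a * z.2)%N); split.
- move=> [i j] [/= ia jb]; apply: (@leq_trans (a * j.+1)).
    by rewrite mulnS ltn_add2r.
  by rewrite leq_pmul2l.
- move=> [i j] [i' j'] /set_mem[/= ia jb] /set_mem[/= ia' jb'] E.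
  have Ei : i = i'.
    have := congr1 (modn^~ a) E.
    by rewrite ![(_ + a * _)%N]addnC ![(a * _)%N]mulnC !modnMDl !modn_small.
  congr (_, _) => //; move: E; rewrite Ei => /addnI /eqP.
  by rewrite eqn_pmul2l // => /eqP.
- move=> n /= nab; exists (n %% a, n %/ a)%N => /=.
    split => /=; first by rewrite ltn_mod.
    by rewrite ltn_divLR // mulnC.
  by rewrite addnC mulnC -divn_eq.
Qed.

Lemma card_dvd_II (a b : nat) : card_dvd `I_a `I_b <-> (a %| b)%N.
Proof.
split => [[V [C bAC]]|/dvdnP[c ->]]; last first.
  by exists nat, `I_c; rewrite mulnC card_eq_sym; apply: card_setX_II.
have [a0|a_gt0] := posnP a.
  move: bAC; rewrite a0 II0 set0X card_eq0 -II0 => /eqP bE.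
  by have := card_eqxx `I_b; rewrite {2}bE => /card_eq_II ->.
have : finite_set C.
  have -> : C = snd @` (`I_a `*` C).
    apply/seteqP; split => [c Cc|_ [[i c] [/= _ Cc] <-]] //.
    by exists (0%N, c).
  apply: finite_image; exists b; by rewrite card_eq_sym.
move=> [c Cc].
have : `I_b #= `I_(a * c).
  apply: card_eq_trans bAC _; apply: card_eq_trans (card_setX_II a c).
  exact: card_eq_setX.
by move/card_eq_II->; rewrite dvdn_mulr.
Qed.

Lemma card_dvd_nat (d : nat) : (0 < d)%N -> card_dvd `I_d [set: nat].
Proof.
move=> d_gt0; exists nat, setT; rewrite card_eq_sym.
apply: (@set_bij_card_eq _ _ _ _ (fun z => z.1 + d * z.2)%N); split => //.
- move=> [i j] [i' j'] /set_mem[/= ia _] /set_mem[/= ia' _] E.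
  have Ei : i = i'.
    have := congr1 (modn^~ d) E.
    by rewrite ![(_ + d * _)%N]addnC ![(d * _)%N]mulnC !modnMDl !modn_small.
  congr (_, _) => //; move: E; rewrite Ei => /addnI /eqP.
  by rewrite eqn_pmul2l // => /eqP.
- move=> n _; exists (n %% d, n %/ d)%N => /=; first by split; rewrite ?ltn_mod.
  by rewrite addnC mulnC -divn_eq.
Qed.
(* A maximal disjoint family of countably infinite subsets of [M] leaves out
   finitely many points, which are added to one of its members. *)
Lemma infinite_card_dvd_nat (T : Type) (M : set T) :
  infinite_set M -> card_dvd [set: nat] M.
Proof.
move=> Minf.
have [E [ED tE maxE]] := ex_maximal_disjoint_subcollection
  (id : set T -> set T) [set S | S `<=` M /\ [set: nat] #= S].
pose R := M `\` \bigcup_(S in E) S.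
(* Otherwise an injection of [nat] into [R] gives a further countably infinite set disjoint from the
   family, against maximality. *)
have Rfin : finite_set R.
  apply: contrapT => Rinf.
  have [f] : $|{injfun [set: nat] >-> R}|.
    have [r0 _] := infinite_setN0 Rinf.
    pose pT : pointedType :=
      HB.pack T (gen_eqMixin T) (gen_choiceMixin T) (isPointed.Build T r0).
    by apply: (@pcard_leP _ pT); apply/infiniteP.
  pose S := f @` [set: nat].
  have SR : S `<=` R by move=> _ [i _ <-]; apply: funS.
  have SM : S `<=` M by move=> s /SR[].
  have SN : [set: nat] #= S by rewrite card_eq_sym; apply: card_image.
  have nES S' : E S' -> S' `&` S !=set0 -> False.
    by move=> ES' [s [S's /SR[_]]]; apply; exists S'.
  apply: (maxE (E `|` [set S])).
  - split => [S' ES'|]; first by left.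
    move=> /(_ S (or_intror erefl)) /nES; apply.
    by exists (f 0%N); split; exists 0%N.
  - by move=> S' [/ED//|->].
  - move=> S1 S2 [E1|->] [E2|->] //; first exact: tE.
    + by move=> /(nES _ E1).
    + by rewrite setIC => /(nES _ E2).
have [S0 ES0] : E !=set0.
  apply/set0P/eqP => E0; apply: Minf.
  by move: Rfin; rewrite /R E0 bigcup_set0 setD0.
have S0N := (ED _ ES0).2; have S0M := (ED _ ES0).1.
apply: (@card_dvd_partition _ _ _ _ ((E `\ S0) `|` [set S0 `|` R])).
- by exists 0%N.
- move=> S [[ES _]|->]; first exact: (ED _ ES).2.
  rewrite card_eq_sym; apply: eq_card_nat.
    have -> : S0 `|` R = \bigcup_(b in [set: bool]) if b then S0 else R.
      apply/seteqP; split => [x [?|?]|x [[] _ ?]].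
      - by exists true.
      - by exists false.
      - by left.
      - by right.
    apply: bigcup_countable => [|[] _]; first exact: countableP.
      by rewrite /countable card_eq_le in S0N *; case/andP: S0N.
    exact: finite_set_countable.
  apply: (@sub_infinite_set _ S0); first by move=> x; left.
  by rewrite -(eq_finite_set S0N); apply: infinite_nat.
- apply/seteqP; split => [x [S [[ES _]|->]]|x Mx].
  + exact: (ED _ ES).1.
  + by move=> [/S0M|[]].
  + have [[S ES Sx]|nx] := pselect ((\bigcup_(S in E) S) x); last first.
      by exists (S0 `|` R); [right|right; split].
    have [SS0|nSS0] := pselect (S = S0).
      by exists (S0 `|` R); [right|left; rewrite -SS0].
    by exists S => //; left.
- have disj S' : (E `\ S0) S' -> S' `&` (S0 `|` R) !=set0 -> False.
    move=> [ES' nS'] [x [S'x [S0x|[_]]]]; last by apply; exists S'.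
    by apply: nS'; apply: tE => //; exists x.
  move=> S1 S2 [E1|->] [E2|->] //.
  + by apply: tE; [case: E1|case: E2].
  + by move=> /(disj _ E1).
  + by rewrite setIC => /(disj _ E2).
Qed.

Lemma infinite_card_dvd_II (T : Type) (M : set T) (d : nat) :
  infinite_set M -> (0 < d)%N -> card_dvd `I_d M.
Proof.
move=> /infinite_card_dvd_nat NM d_gt0.
exact: card_dvd_trans (card_dvd_nat d_gt0) NM.
Qed.

(** An infinite [M] is divisible by every positive [d]; for finite [M] divisibility is tested on the
    prime power parts of [d]. *)
Lemma card_dvd_II_primes (T : Type) (M : set T) (d : nat) :
  (0 < d)%N -> (forall p, prime p -> card_dvd `I_(p ^ logn p d) M) ->
  card_dvd `I_d M.
Proof.
move=> d_gt0 pM; have [[N MN]|Minf] := pselect (finite_set M); last first.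
  exact: infinite_card_dvd_II.
apply: (@card_dvd_eqr _ _ _ _ `I_N); first by rewrite card_eq_sym.
apply/card_dvd_II/(dvdn_partP _ d_gt0) => p pd; rewrite p_part.
apply/card_dvd_II/(card_dvd_eqr MN)/pM.
by move: pd; rewrite mem_primes => /andP[].
Qed.

(** The orders in [F] are divisors of [m], hence finitely many, and their numerical LCM divides [m].
    Its universal property extends to infinite [M], which every positive integer divides. *)
Lemma bounded_card_lcm (S : Type) (F : set (set S)) (m : nat) :
  (0 < m)%N -> (forall A, F A -> exists2 d, A #= `I_d & d %| m) ->
  exists l, is_card_lcm F `I_l.
Proof.
move=> m_gt0 Fm; pose P (d : 'I_m.+1) := `[< exists2 A, F A & A #= `I_d >].
exists (\big[lcmn/1%N]_(d | P d) d)%N.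
have lm : \big[lcmn/1%N]_(d | P d) d %| m.
  apply/dvdn_biglcmP => i /asboolP[A /Fm[d Ad dm]] Ai.
  by rewrite (@card_eq_II i d _) // (card_eq_trans _ Ad) // card_eq_sym.
split => [A FA|U M FM].
  have [d Ad dm] := Fm A FA.
  apply: (@card_dvd_eql _ _ _ `I_d); first by rewrite card_eq_sym.
  have dm1 : d < m.+1 by rewrite ltnS dvdn_leq.
  apply/card_dvd_II/(biglcmn_sup (Ordinal dm1)) => //.
  by apply/asboolP; exists A.
have [[N MN]|Minf] := pselect (finite_set M); last first.
  by apply: infinite_card_dvd_II => //; apply: dvdn_gt0 lm.
apply: (@card_dvd_eqr _ _ _ _ `I_N); first by rewrite card_eq_sym.
apply/card_dvd_II/dvdn_biglcmP => i /asboolP[A FA Ai].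
by apply/card_dvd_II/(card_dvd_eqr MN)/(card_dvd_eql Ai)/FM.
Qed.

Lemma card_image_finset (T : finType) (U : Type) (f : T -> U) (A : {set T}) :
  injective f -> f @` [set` A] #= `I_#|A|.
Proof.
move=> f_inj.
have : f @` [set` A] #= [set` A].
  by apply: inj_card_eq => x y _ _; apply: f_inj.
move=> /card_eq_trans; apply.
apply: (@set_bij_card_eq _ _ _ _ (fun x => index x (enum A))); split.
- by move=> x /= xA; rewrite cardE index_mem mem_enum.
- move=> x y /set_mem /= xA /set_mem /= yA /= E;
    by apply: (index_inj x _ _ E); rewrite mem_enum.
- move=> i /=; rewrite cardE => iA.
  have [x0 _] : exists x0 : T, true.
    by case: (enum A) iA => // x0; exists x0.
  exists (nth x0 (enum A) i); first by rewrite -mem_enum mem_nth.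
  by rewrite index_uniq ?enum_uniq.
Qed.

(** * Finite groups: powers of the elements of a coset of a [p]-subgroup *)

Local Open Scope group_scope.

(** Induction on the order of [D]. A nontrivial [D] meets the centre of [Q], so it contains a
    central [Z] of order [p]. Modulo [Z] the powers of exponent [#|D / Z|] agree; the discrepancy is
    central in [Q] and killed by the [p]-th power. *)
Lemma pgroup_coset_expg (p : nat) (gT : finGroupType) (Q D : {group gT})
    (x d : gT) :
  p.-group Q -> D <| Q -> x \in Q -> d \in D ->
  (x * d) ^+ #|D| = x ^+ #|D|.
Proof.
have [m] := ubnP #|D|; elim: m gT Q D x d => // m IHm gT Q D x d ltDm pQ nDQ xQ dD.
have [D1|ntD] := eqVneq D 1%G.
  by move: dD; rewrite D1 => /finset.set1P ->; rewrite mulg1.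
have pD : p.-group D := pgroupS (normal_sub nDQ) pQ.
have [p_pr _ _] := pgroup_pdiv pD ntD.
have ntZ : D :&: 'Z(Q) != 1 by apply: meet_center_nil (pgroup_nil pQ) nDQ ntD.
have [_ pDZ _] := pgroup_pdiv (pgroupS (finset.subsetIl _ _) pD) ntZ.
have [z zDZ oz] := Cauchy p_pr pDZ.
have [zD zZ] := finset.setIP zDZ.
pose Z := <[z]>%G.
have sZD : Z \subset D by rewrite cycle_subG.
have nZQ : Z <| Q.
  by apply: sub_center_normal; rewrite cycle_subG.
have nZx : x \in 'N(Z) := fintype.subsetP (normal_norm nZQ) x xQ.
have dQ : d \in Q := fintype.subsetP (normal_sub nDQ) d dD.
have nZd : d \in 'N(Z) := fintype.subsetP (normal_norm nZQ) d dQ.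
have oD : #|D| = (#|D / Z| * p)%N.
  rewrite card_quotient ?(fintype.subset_trans (normal_sub nDQ) (normal_norm nZQ)) //.
  by rewrite -oz mulnC /order Lagrange.
have := IHm _ (Q / Z)%G (D / Z)%G (coset Z x) (coset Z d).
rewrite /= quotient_pgroup // quotient_normal // !mem_quotient //.
move=> IH.
have {}IH : coset Z ((x * d) ^+ #|D / Z|) = coset Z (x ^+ #|D / Z|).
  rewrite !morphX ?groupM //= morphM //; apply: IH => //.
  rewrite -ltnS; apply: leq_trans ltDm; rewrite ltnS oD.
  by rewrite ltn_Pmulr ?prime_gt1 ?cardG_gt0.
have /rcosetP[w wZ E] : (x * d) ^+ #|D / Z| \in Z :* (x ^+ #|D / Z|).
  apply/rcoset_kercosetP; rewrite ?groupX ?groupM //.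
have wC : commute w (x ^+ #|D / Z|).
  have /finset.setIP[_ /centP cw] : w \in 'Z(Q).
    by apply: (fintype.subsetP _ w wZ); rewrite cycle_subG.
  by apply: cw; rewrite groupX.
rewrite oD !expgM E expgMn //.
have -> : w ^+ p = 1 by apply/eqP; rewrite -order_dvdn -oz order_dvdG.
by rewrite mul1g.
Qed.

(* If [r] is the [p']-part of [k], then [x ^+ r] is a [p]-element, and the powers
   [(x * d) ^+ r] remain in the coset [x ^+ r D] of the [p]-group [<x ^+ r> D]. *)
Lemma coset_expg_eq1 (p : nat) (gT : finGroupType) (D : {group gT})
    (x d : gT) (k : nat) :
  p.-group D -> #|D| %| k -> x \in 'N(D) -> d \in D ->
  x ^+ k = 1 -> (x * d) ^+ k = 1.
Proof.
move=> pD; have [->|k_gt0] := posnP k; first by rewrite !expg0.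
move=> Dk xN dD xk.
pose r := (k`_p^')%N; pose q := (k`_p)%N.
have Ek : k = (r * q)%N by rewrite mulnC partnC.
have Dq : #|D| %| q.
  have [n oD] := p_natP pD.
  by rewrite -(part_pnat_id pD) partn_dvd.
have pgrp : p.-group (<[x ^+ r]> <*> D)%G.
  have pxr : p.-group <[x ^+ r]>.
    rewrite /pgroup -[#|_|]/(#[_]); apply: pnat_dvd (part_pnat p k).
    by rewrite order_dvdn -expgM -Ek xk.
  rewrite /= norm_joinEl ?cycle_subG ?groupX // pgroupM.
  by rewrite pxr.
have nDQ : D <| <[x ^+ r]> <*> D.
  rewrite /normal joing_subr join_subG normG andbT cycle_subG.
  by rewrite groupX.
(* Modulo [D] the factor [d] vanishes, so both [r]-th powers lie in one coset of [D]. *)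
have [u uD Eu] : exists2 u, u \in D & (x * d) ^+ r = x ^+ r * u.
  exists (x ^- r * (x * d) ^+ r); last by rewrite mulgA mulgV mul1g.
  apply: coset_idr; rewrite ?groupM ?groupV ?groupX ?groupM //.
    exact: (fintype.subsetP (normG D)).
  rewrite morphM ?groupV ?groupX ?groupM //; last exact: (fintype.subsetP (normG D)).
  have dN : d \in 'N(D) := fintype.subsetP (normG D) d dD.
  rewrite morphV ?groupX // !morphX ?groupM //= morphM //= (coset_id dD) mulg1.
  by rewrite mulVg.
case/dvdnP: Dq => c Eq.
rewrite Ek expgM Eu Eq mulnC expgM (pgroup_coset_expg pgrp) //.
  by rewrite -!expgM mulnA -mulnA [(_ * c)%N]mulnC -Eq -Ek xk.
by rewrite mem_gen // inE cycle_id.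
Qed.

(** Gives access to finite group theory inside an arbitrary group: the elements of [H], listed in a
    sequence, carry a [finGroupType] embedded by [ssval]. *)
Lemma finite_subgroup_fingroup (G : groupType) (H : set G) :
  is_subgroup H -> finite_set H ->
  exists (gT : finGroupType) (f : UMagmaMorphism.type gT G),
    injective f /\ range f = H.
Proof.
move=> Hsub /finite_seqP[s Hs].
have [s1 sF] : group_closed (mem s).
  split; first by case: Hsub => + _; rewrite Hs inE.
  move=> x y xs ys; case: Hsub => _ /(_ x y).
  by rewrite Hs !inE /=; apply.
have sV : forall x, x \in s -> x^-1 \in s.
  by move=> x xs; rewrite -div1g; apply: sF.
have sM : forall x y, x \in s -> y \in s -> x * y \in s.
  by move=> x y xs ys; rewrite -[y]invgK; apply: sF => //; apply: sV.
pose T := seq_sub s.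
pose one : T := SeqSub s1.
pose mul (x y : T) : T := SeqSub (sM _ _ (ssvalP x) (ssvalP y)).
pose inv (x : T) : T := SeqSub (sV _ (ssvalP x)).
have mulA : associative mul by move=> x y z; apply: val_inj; rewrite /= mulgA.
have mul1 : left_id one mul by move=> x; apply: val_inj; rewrite /= mul1g.
have mulV : left_inverse one inv mul.
  by move=> x; apply: val_inj; rewrite /= mulVg.
pose gT : finGroupType := HB.pack T (Finite_isGroup.Build T mulA mul1 mulV).
have fM : monoid_morphism (@ssval _ s : gT -> G) by [].
pose f : UMagmaMorphism.type gT G := HB.pack (@ssval _ s : gT -> G)
  (isUMagmaMorphism.Build gT G (@ssval _ s) fM).
exists gT, f; split.
  exact: val_inj.
apply/seteqP; split => [_ [y _ <-]|y]; rewrite Hs /=; first exact: ssvalP.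
by move=> ys; exists (SeqSub ys).
Qed.

(** * Subgroups of an arbitrary group, and Lagrange's theorem for cardinals *)

Section Subgroups.
Variable G : groupType.
Implicit Types (H K : set G) (x y g : G).

Lemma is_subgroupP H :
  H 1 -> (forall x y, H x -> H y -> H (x * y)) -> (forall x, H x -> H x^-1) ->
  is_subgroup H.
Proof.
move=> H1 HM HV; split; first by rewrite inE.
by move=> x y; rewrite !inE /= => Hx Hy; apply: HM => //; apply: HV.
Qed.

Lemma subgroup1 H : is_subgroup H -> H 1.
Proof. by case; rewrite inE. Qed.

Lemma subgroupV H x : is_subgroup H -> H x -> H x^-1.
Proof. by move=> /group_closedV /(_ x); rewrite !inE. Qed.

Lemma subgroupM H x y : is_subgroup H -> H x -> H y -> H (x * y).
Proof. by move=> /group_closedM /(_ x y); rewrite !inE /=; apply. Qed.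

Lemma subgroupJ H x y : is_subgroup H -> H x -> H y -> H (x ^ y).
Proof.
move=> sH Hx Hy; rewrite conjgE.
by apply: subgroupM => //; [apply: subgroupV|apply: subgroupM].
Qed.

Lemma generated_subgroup (A : set G) : is_subgroup (generated A).
Proof.
apply: is_subgroupP => [S [sS _]|x y Hx Hy S AS|x Hx S AS].
- exact: subgroup1.
- by apply: subgroupM; [case: AS|apply: Hx|apply: Hy].
- by apply: subgroupV; [case: AS|apply: Hx].
Qed.

Lemma sub_generated (A : set G) : A `<=` generated A.
Proof. exact: sub_smallest. Qed.

Lemma generated_sub (A : set G) H :
  is_subgroup H -> A `<=` H -> generated A `<=` H.
Proof. by move=> sH AH x; apply. Qed.

Lemma expgz_eq1 g (k : int) : expgz g k = 1 <-> g ^+ `|k|%N = 1.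
Proof.
case: k => k //=; split=> [/eqP|E]; last by rewrite E invg1.
by rewrite invg_eq1 => /eqP.
Qed.

(** The cosets [x H] partition [K], and left multiplication by [x] maps [H] onto the coset of
    [x]. *)
Lemma card_dvd_subgroup H K :
  is_subgroup H -> is_subgroup K -> H `<=` K -> card_dvd H K.
Proof.
move=> sH sK HK.
apply: (@card_dvd_equiv _ _ _ _ (fun x y => H (x^-1 * y))).
- by exists 1; apply: subgroup1.
- by move=> x _; rewrite mulVg; apply: subgroup1.
- by move=> x y _ _ /(subgroupV sH); rewrite invgM invgK.
- move=> x y z _ _ _ xy yz.
  by rewrite -(mulgK y x^-1) -mulgA; apply: subgroupM.
- move=> x Kx; apply: (@set_bij_card_eq _ _ _ _ (mulg x)); split.
  + by move=> y Hy; split; [apply: subgroupM => //; apply: HK|rewrite mulKg].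
  + by move=> y z _ _ /mulgI.
  + by move=> y [_ Hxy]; exists (x^-1 * y); rewrite ?mulVKg.
Qed.

End Subgroups.

(** * Conjugating and shifting tuples, and counting by orbits of blocks *)

Section Twist.
Variables (G : groupType) (n : nat) (j : 'I_n) (P : set G).
Hypothesis sP : is_subgroup P.
Implicit Types (g : n.-tuple G) (h d x y : G).

Definition conj_tuple g h : n.-tuple G := [tuple tnth g i ^ h | i < n].

Definition shift_tuple g d : n.-tuple G :=
  [tuple if i == j then tnth g i * d else tnth g i | i < n].

(* The largest subset of the centraliser in [P] of the [g_i], [i != j], that is
   normalised by [g_j]; being the largest, it is a subgroup. *)
Definition shift_core g : set G :=
  [set h | exists2 E : set G, E h &
    forall y, E y -> [/\ P y, forall i, i != j -> commute (tnth g i) y,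
                        E (y ^ tnth g j) & E (y ^ (tnth g j)^-1)]].

Lemma conj_tupleM g h h' :
  conj_tuple (conj_tuple g h) h' = conj_tuple g (h * h').
Proof. by apply: eq_from_tnth => i; rewrite !tnth_mktuple conjgM. Qed.

Lemma conj_tuple1 g : conj_tuple g 1 = g.
Proof. by apply: eq_from_tnth => i; rewrite !tnth_mktuple conjg1. Qed.

Lemma shift_tupleM g d d' :
  shift_tuple (shift_tuple g d) d' = shift_tuple g (d * d').
Proof.
by apply: eq_from_tnth => i; rewrite !tnth_mktuple; case: eqP; rewrite ?mulgA.
Qed.

Lemma shift_tuple1 g : shift_tuple g 1 = g.
Proof.
by apply: eq_from_tnth => i; rewrite !tnth_mktuple mulg1; case: eqP.
Qed.

Lemma shift_tuple_inj g : injective (shift_tuple g).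
Proof.
move=> d d' /(congr1 (fun t => tnth t j)).
by rewrite !tnth_mktuple eqxx => /mulgI.
Qed.

Lemma conj_shift_tuple g d h :
  conj_tuple (shift_tuple g d) h = shift_tuple (conj_tuple g h) (d ^ h).
Proof.
by apply: eq_from_tnth => i; rewrite !tnth_mktuple; case: eqP; rewrite ?conjMg.
Qed.

Lemma shift_coreP g y : shift_core g y ->
  [/\ P y, forall i, i != j -> commute (tnth g i) y,
      shift_core g (y ^ tnth g j) & shift_core g (y ^ (tnth g j)^-1)].
Proof.
move=> [E Ey EP]; have [Py cy Ey1 Ey2] := EP _ Ey.
by split=> //; exists E.
Qed.

Lemma shift_core_subgroup g : is_subgroup (shift_core g).
Proof.
apply: is_subgroupP.
- exists [set 1] => // _ ->; rewrite !conj1g; split=> //; first exact: subgroup1.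
  by move=> i _; apply: commute1.
(* The products of two core elements form a set with the required closure, so they lie in the
   core. *)
- move=> x y Dx Dy; exists [set z | exists x' y',
    [/\ shift_core g x', shift_core g y' & z = x' * y']].
    by exists x, y.
  move=> _ [x' [y' [/shift_coreP[Px cx x1 x2] /shift_coreP[Py cy y1 y2] ->]]].
  split; first exact: subgroupM.
  + by move=> i ij; apply: commuteM; auto.
  + by exists (x' ^ tnth g j), (y' ^ tnth g j); rewrite conjMg.
  + by exists (x' ^ (tnth g j)^-1), (y' ^ (tnth g j)^-1); rewrite conjMg.
- move=> x Dx; exists [set z | shift_core g z^-1]; first by rewrite /= invgK.
  move=> y /shift_coreP[Py cy y1 y2]; rewrite -[y]invgK; split.
  + exact: subgroupV.
  + by move=> i ij; apply: commuteV; auto.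
  + by rewrite /= conjVg invgK.
  + by rewrite /= conjVg invgK.
Qed.

Lemma sub_shift_core_shift g d : shift_core g d ->
  shift_core g `<=` shift_core (shift_tuple g d).
Proof.
have sD := shift_core_subgroup g.
(* The old core is the witness: [tnth g j * d] normalises it, since [tnth g j] does and [d] lies in
   it. *)
move=> Dd y Dy; exists (shift_core g) => // z /[dup] Dz /shift_coreP[Pz cz z1 z2].
rewrite !tnth_mktuple eqxx; split=> //.
- by move=> i ij; rewrite tnth_mktuple (negbTE ij); apply: cz.
- by rewrite conjgM; apply: subgroupJ.
- rewrite invgM conjgM.
  have := subgroupJ sD Dz (subgroupV sD Dd).
  by case/shift_coreP.
Qed.

Lemma shift_core_shift g d : shift_core g d ->
  shift_core (shift_tuple g d) = shift_core g.
Proof.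
move=> Dd; apply/seteqP; split; last exact: sub_shift_core_shift.
have := @sub_shift_core_shift (shift_tuple g d) d^-1.
rewrite shift_tupleM mulgV shift_tuple1; apply.
apply: subgroupV; first exact: shift_core_subgroup.
exact: (sub_shift_core_shift Dd).
Qed.

Lemma shift_core_conj g h y : P h -> shift_core g y ->
  shift_core (conj_tuple g h) (y ^ h).
Proof.
move=> Ph Dy; exists [set z ^ h | z in shift_core g]; first by exists y.
move=> _ [z /shift_coreP[Pz cz z1 z2] <-]; split; first exact: subgroupJ.
- move=> i ij; rewrite tnth_mktuple /commute -!conjMg.
  by congr (_ ^ _); apply: cz.
- by rewrite tnth_mktuple -conjJg; exists (z ^ tnth g j).
- by rewrite tnth_mktuple -conjVg -conjJg; exists (z ^ (tnth g j)^-1).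
Qed.

(** Comparing entries shows that [h] commutes with the [g_i], [i != j], and that conjugation by
    [g_j] or its inverse multiplies [h] by an element of the core [D]. Hence the coset [h D] has the
    closure property defining the core. *)
Lemma shift_core_stab g h d : P h -> shift_core g d ->
  conj_tuple g h = shift_tuple g d -> shift_core g h.
Proof.
move=> Ph Dd E; have sD := shift_core_subgroup g.
have ch i : i != j -> commute (tnth g i) h.
  move=> ij; have := congr1 (fun t => tnth t i) E.
  rewrite !tnth_mktuple (negbTE ij) => Ei.
  by rewrite /commute conjgC Ei.
have := congr1 (fun t => tnth t j) E.
rewrite !tnth_mktuple eqxx; set x := tnth g j => Ej.
have hx : h ^ x = h * d^-1.
  apply: (mulgI (h^-1)); rewrite mulKg; apply: invg_inj.
  rewrite invgK invgM invgK -[d](mulKg x) -Ej !conjgE !invgM.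
  by rewrite !invgK !mulgA.
have hx' : h ^ x^-1 = h * d ^ x^-1.
  have := congr1 (conjg^~ x^-1) hx.
  rewrite /= conjgK conjMg conjVg => {2}->.
  by rewrite mulgVK.
exists [set z | exists2 d', shift_core g d' & z = h * d'].
  by exists 1; [apply: subgroup1|rewrite mulg1].
move=> _ [d' /shift_coreP[Pd cd d1 d2] ->]; split.
- exact: subgroupM.
- by move=> i ij; apply: commuteM; auto.
- rewrite conjMg hx -mulgA; eexists; last by [].
  by apply: subgroupM => //; apply: subgroupV.
- rewrite conjMg hx' -mulgA; eexists; last by [].
  by apply: subgroupM => //; case/shift_coreP: Dd.
Qed.

(** Since [h] commutes with the other entries, conjugation by [h] only multiplies [g_j] by the
    commutator [[~ g_j, h]], which lies in the core. *)
Lemma conj_shift_core g h : shift_core g h ->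
  exists2 d, shift_core g d & conj_tuple g h = shift_tuple g d.
Proof.
move=> Dh; have sD := shift_core_subgroup g; have [Ph ch h1 h2] := shift_coreP Dh.
exists ((h^-1 ^ tnth g j) * h).
  by apply: subgroupM => //; rewrite conjVg; apply: subgroupV.
apply: eq_from_tnth => i; rewrite !tnth_mktuple; case: eqP => [->|/eqP ij].
  by rewrite !conjgE !mulgA mulgV mul1g.
by rewrite conjgE ch // mulKg.
Qed.

(* [P] permutes the blocks [shift_tuple g @` shift_core g] by conjugation, and
   the stabiliser of a block is its core, so that each union of an orbit of
   blocks has as many elements as [P]. *)
Lemma card_dvd_twist (M : set (n.-tuple G)) :
  (forall g h, M g -> P h -> M (conj_tuple g h)) ->
  (forall g d, M g -> shift_core g d -> M (shift_tuple g d)) ->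
  card_dvd P M.
Proof.
move=> Mconj Mshift.
apply: (@card_dvd_equiv _ _ _ _ (fun g g' => exists h d,
  [/\ P h, shift_core g d & g' = conj_tuple (shift_tuple g d) h])).
- by exists 1; apply: subgroup1.
- move=> g _; exists 1, 1; split.
  + exact: subgroup1.
  + by apply: subgroup1; apply: shift_core_subgroup.
  + by rewrite shift_tuple1 conj_tuple1.
- move=> g _ _ _ [h [d [Ph Dd ->]]]; exists h^-1, (d^-1 ^ h); split.
  + exact: subgroupV.
  + rewrite conj_shift_tuple shift_core_shift; last exact: shift_core_conj.
    apply: shift_core_conj => //; apply: subgroupV => //.
    exact: shift_core_subgroup.
  + rewrite -conj_shift_tuple conj_tupleM mulgV conj_tuple1.
    by rewrite shift_tupleM mulgV shift_tuple1.
- move=> g _ _ _ _ _ [h [d [Ph Dd ->]]] [h' [d' [Ph' Dd' ->]]].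
  exists (h * h'), (d * d' ^ h^-1); split; first exact: subgroupM.
  + apply: subgroupM => //; first exact: shift_core_subgroup.
    rewrite -(shift_core_shift Dd).
    have := shift_core_conj (subgroupV sP Ph) Dd'.
    by rewrite conj_tupleM mulgV conj_tuple1.
  + by rewrite -shift_tupleM -conj_tupleM [in RHS]conj_shift_tuple conjgKV.
- move=> g Mg; have sD := shift_core_subgroup g.
  (* [t h] is a fixed representative of the coset [D h] of the core [D]; the default [1] of [xget]
     is never reached, as [h] lies in its own coset. *)
  pose coset h := [set z | shift_core g (z * h^-1)].
  pose t h := xget 1 (coset h).
  have tP h : shift_core g (t h * h^-1).
    rewrite /t; case: xgetP => [z _ //|/(_ h)].
    by case; rewrite /coset /= mulgV; apply: subgroup1.
  have eq_t h h' : shift_core g (h * h'^-1) -> t h = t h'.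
    move=> Dhh'; congr xget; apply/seteqP; split => z; rewrite /coset /= => Dz.
      by rewrite -(mulgVK h z) -mulgA; apply: subgroupM.
    rewrite -(mulgVK h' z) -mulgA; apply: subgroupM => //.
    by rewrite -[h' * _]invgK invgM invgK; apply: subgroupV.
  have tV h : shift_core g (h * (t h)^-1).
    by rewrite -[h * _]invgK invgM invgK; apply: subgroupV.
  have Pt h : P h -> P (t h).
    move=> Ph; rewrite -(mulgVK h (t h)); apply: subgroupM => //.
    by case/shift_coreP: (tP h).
  (* Write [h] as [e * t h] with [e] in the core: [e] selects a point in the block of [g], and [t h]
     moves that block along its orbit. *)
  apply: (@set_bij_card_eq _ _ _ _
    (fun h => conj_tuple (shift_tuple g (h * (t h)^-1)) (t h))); split.
  + move=> h Ph; split; first by apply: Mconj; [apply: Mshift|apply: Pt].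
    by exists (t h), (h * (t h)^-1); split; [apply: Pt| |].
  + move=> h h' /set_mem Ph /set_mem Ph' E.
    (* Equal images make [t h * (t h')^-1] stabilise the block of [g], so it lies in the core and
       the representatives coincide. *)
    have E1 : conj_tuple (shift_tuple g (h * (t h)^-1)) (t h * (t h')^-1) =
        shift_tuple g (h' * (t h')^-1).
      by rewrite -conj_tupleM E conj_tupleM mulgV conj_tuple1.
    have Dtt : shift_core g (t h * (t h')^-1).
      rewrite -(shift_core_shift (tV h)).
      apply: (@shift_core_stab _ _ ((h * (t h)^-1)^-1 * (h' * (t h')^-1))).
      * by apply: subgroupM; [|apply: Pt|apply: subgroupV => //; apply: Pt].
      * rewrite shift_core_shift //; apply: subgroupM => //.
        exact: subgroupV.
      * by rewrite shift_tupleM mulVKg.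
    have tt : t h = t h'.
      apply: eq_t.
      rewrite -(mulgVK (t h) h) -mulgA; apply: subgroupM => //.
      by rewrite -(mulgVK (t h') (t h)) -mulgA; apply: subgroupM.
    move: E1; rewrite tt mulgV conj_tuple1 => /shift_tuple_inj.
    by rewrite -tt => /mulIg.
  + move=> _ [_ [h [d [Ph Dd ->]]]].
    (* [h] is a core element times [t h]. Conjugation by this core element is a shift by some [d']
       within the block, whence the preimage [d * d' * t h]. *)
    have De := tV h; rewrite -(shift_core_shift Dd) in De.
    have [d' Dd' E] := conj_shift_core De.
    rewrite shift_core_shift // in Dd'.
    exists (d * d' * t h).
      apply: subgroupM => //; last exact: Pt.
      have := subgroupM sD Dd Dd'.
      by case/shift_coreP.
    have -> : t (d * d' * t h) = t h.
      apply: eq_t; rewrite -mulgA; apply: subgroupM => //.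
      exact: subgroupM.
    by rewrite mulgK -shift_tupleM -E conj_tupleM mulgVK.
Qed.

End Twist.

(** * Finite subgroups: exponents, Sylow subgroups and powers in cosets *)

Lemma card_finset_eq (T : finType) (U : Type) (f : T -> U) (A : {set T})
    (d : nat) : injective f -> f @` [set` A] #= `I_d -> #|A| = d.
Proof.
move=> f_inj Ad; apply/card_eq_II; apply: card_eq_trans Ad.
by rewrite card_eq_sym; apply: card_image_finset.
Qed.

Lemma set_mem_setT (T : finType) : [set` [set: T]%SET] = [set: T].
Proof. by apply/seteqP; split => x //= _; rewrite finset.in_setT. Qed.

Section FiniteSubgroups.
Variable G : groupType.
Implicit Types P D H : set G.

Lemma finite_subgroup_expg P (d : nat) (y : G) :
  is_subgroup P -> P #= `I_d -> P y -> y ^+ d = 1.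
Proof.
move=> sP oP; have [|gT [f [f_inj fP]]] := finite_subgroup_fingroup sP.
  by exists d.
rewrite -fP => -[u _ <-]; rewrite -gmulfXn.
have <- : #|[set: gT]%SET| = d.
  by apply: (card_finset_eq f_inj); rewrite set_mem_setT fP.
by rewrite (expg_cardG (G := [set: gT]%G)) ?finset.in_setT // gmulf1.
Qed.

Lemma finite_subgroup_sylow H (d p : nat) :
  is_subgroup H -> H #= `I_d ->
  exists P, [/\ is_subgroup P, P `<=` H & P #= `I_(p ^ logn p d)].
Proof.
move=> sH oH; have [|gT [f [f_inj fH]]] := finite_subgroup_fingroup sH.
  by exists d.
have [S /card_Hall oS] := Sylow_exists p [set: gT]%G.
exists (f @` [set` S]); split.
- apply: is_subgroupP; first by exists 1; rewrite ?gmulf1 //= group1.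
  + move=> _ _ [u /= uS <-] [v /= vS <-].
    by exists (u * v); rewrite ?gmulfM //= groupM.
  + by move=> _ [u /= uS <-]; exists u^-1; rewrite ?gmulfV //= groupV.
- by rewrite -fH => _ [u _ <-]; exists u.
- have <- : #|[set: gT]%SET| = d.
    by apply: (card_finset_eq f_inj); rewrite set_mem_setT fH.
  by rewrite -p_part -oS; apply: card_image_finset.
Qed.

(* As [x ^+ k = 1], the elements [x ^+ i * y] with [y] in [D] form a finite group,
   which reduces the claim to [coset_expg_eq1]. *)
Lemma pgroup_shift_expg P D (p a k : nat) (x d : G) :
  prime p -> P #= `I_(p ^ a) -> p ^ a %| k -> is_subgroup P ->
  is_subgroup D -> D `<=` P -> D d ->
  (forall y, D y -> D (y ^ x)) -> x ^+ k = 1 -> (x * d) ^+ k = 1.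
Proof.
move=> p_pr oP pk sP sD DP Dd Dx xk.
have [->|k_gt0] := posnP k; first by rewrite expg0.
have DxX i y : D y -> D (y ^ (x ^+ i)).
  move=> Dy; elim: i => [|i IHi]; first by rewrite conjg1.
  by rewrite expgSr conjgM; apply: Dx.
(* As [x ^+ k = 1], inverses of powers of [x] are powers with natural exponents, which makes [Q]
   closed under inverses. *)
have xV i : (x ^+ i)^-1 = x ^+ (i * k.-1).
  apply: mulg1_eq; rewrite -expgnDr -mulnS prednK //.
  by rewrite mulnC expgnA xk expg1n.
pose Q := [set z | exists i y, D y /\ z = x ^+ i * y].
have sQ : is_subgroup Q.
  apply: is_subgroupP.
  - by exists 0%N, 1; rewrite expg0 mulg1; split=> //; apply: subgroup1.
  - move=> _ _ [i [y [Dy ->]]] [l [z [Dz ->]]].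
    exists (i + l)%N, (y ^ (x ^+ l) * z); split.
      by apply: subgroupM => //; apply: DxX.
    by rewrite expgnDr !mulgA -(mulgA _ y) (conjgC y) !mulgA.
  - move=> _ [i [y [Dy ->]]]; exists (i * k.-1)%N, (y^-1 ^ (x ^+ (i * k.-1))).
    split; first by apply: DxX; apply: subgroupV.
    by rewrite invgM xV -conjgC.
have finP : finite_set P by exists (p ^ a)%N.
have finD : finite_set D := sub_finite_set DP finP.
have finQ : finite_set Q.
  apply: (@sub_finite_set _ _ [set x ^+ i * y | i in `I_k & y in D]); last first.
    exact: finite_image2.
  move=> _ [i [y [Dy ->]]]; exists (i %% k)%N; first by rewrite /= ltn_mod.
  by exists y => //; rewrite {2}(divn_eq i k) expgnDr mulnC expgnA xk expg1n mul1g.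
have [gT [f [f_inj fQ]]] := finite_subgroup_fingroup sQ finQ.
pose D' := [set y | `[< D (f y) >]]%SET.
have gD' : group_set D'.
  apply/group_setP; split=> [|u v].
    by rewrite !inE gmulf1; apply: subgroup1 sD.
  by rewrite !inE gmulfM ; apply: subgroupM.
pose H := Group gD'.
have DQ : D `<=` Q by move=> y Dy; exists 0%N, y; rewrite expg0 mul1g.
have fD : f @` [set` D'] = D.
  apply/seteqP; split => [_ [u /= + <-]|y Dy]; first by rewrite !inE.
  have := DQ y Dy; rewrite -fQ => -[u _ uy]; exists u => //=.
  by rewrite !inE uy.
have oD : #|H| %| p ^ a.
  apply/card_dvd_II/(card_dvd_eqr oP)/(card_dvd_eql _ (card_dvd_subgroup sD sP DP)).
  by rewrite -fD; apply: card_image_finset.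
have [x' _ fx] : range f x.
  by rewrite fQ; exists 1%N, 1; rewrite mulg1 expg1; split=> //; apply: subgroup1.
have [d' _ fd] : range f d by rewrite fQ; apply: DQ.
have x'k : x' ^+ k = 1 by apply: f_inj; rewrite gmulfXn fx xk gmulf1.
have := @coset_expg_eq1 p gT H x' d' k.
rewrite -fx -fd -gmulfM -gmulfXn => -> //.
- by rewrite gmulf1.
- by rewrite /pgroup; apply: pnat_dvd oD _; rewrite pnatX pnat_id.
- exact: dvdn_trans pk.
- rewrite inE; apply/fintype.subsetP => _ /imsetP[u /= uD ->].
  move: uD; rewrite !inE => uD.
  by rewrite gmulfJ fx; apply: Dx.
- by rewrite !inE fd.
Qed.

End FiniteSubgroups.

(** * Generating tuples under conjugation and shifts *)

Section Generation.
Variables (G : groupType) (n : nat).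
Implicit Types (g : n.-tuple G) (S H K : set G).

Lemma generated_tupleP g :
  generated [set` g] = [set: G] <->
  (forall S, is_subgroup S -> (forall i, S (tnth g i)) -> forall y, S y).
Proof.
split=> [gG S sS Sg y|gG].
  have : generated [set` g] y by rewrite gG.
  by apply: generated_sub => // _ /= /tnthP[i ->].
apply/seteqP; split => // y _; apply: gG; first exact: generated_subgroup.
by move=> i; apply: sub_generated; rewrite /= mem_tnth.
Qed.

Lemma conj_tuple_generates g h :
  generated [set` g] = [set: G] ->
  generated [set` conj_tuple g h] = [set: G].
Proof.
move=> /generated_tupleP gG; apply/generated_tupleP => S sS Sg y.
(* The [z] with [z ^ h] in [S] form a subgroup containing every [g_i], hence all of [G]. *)
rewrite -(conjgKV h y).
apply: (gG [set z | S (z ^ h)]) => [|i]; last first.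
  by have := Sg i; rewrite tnth_mktuple.
apply: is_subgroupP => /= [|u v Su Sv|u Su].
- by rewrite conj1g; apply: subgroup1.
- by rewrite conjMg; apply: subgroupM.
- by rewrite conjVg; apply: subgroupV.
Qed.

Lemma subgroup_expgz S (y : G) (k : int) :
  is_subgroup S -> S (y ^+ `|k|%N) -> S (expgz y k).
Proof. by case: k => k //= sS; apply: subgroupV. Qed.

(* With [x = g_j], [D] the core and [K] generated by the shifted tuple: [W], the
   intersection of [K] with the centraliser of [D], is normal in [G] as [x] and
   [x d] act alike on it. Then [G / W] is generated by the image of [x], so that
   [G' <= W <= K]; moreover [G = K D] and [D] has exponent dividing [m], so that
   [G^m <= K] and [D <= G' G^m <= K]. *)
Lemma shift_tuple_generates (j : 'I_n) (P : set G) (m : int) g d :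
  is_subgroup P ->
  P `<=` set_mulg (commutator_subgroup G) (power_subgroup G m) ->
  (forall y, P y -> y ^+ `|m|%N = 1) -> shift_core j P g d ->
  generated [set` g] = [set: G] ->
  generated [set` shift_tuple j g d] = [set: G].
Proof.
move=> sP PX Pm Dd /generated_tupleP gG; apply/generated_tupleP => K sK Kg.
pose x := tnth g j; pose D := shift_core j P g; have sD : is_subgroup D.
  exact: shift_core_subgroup.
have Kxd : K (x * d) by have := Kg j; rewrite tnth_mktuple eqxx.
have Kgi i : i != j -> K (tnth g i).
  by move=> ij; have := Kg i; rewrite tnth_mktuple (negbTE ij).
have gind S : is_subgroup S -> S x ->
    (forall i, i != j -> S (tnth g i)) -> forall y, S y.
  by move=> sS Sx Sg; apply: gG => // i; have [->//|/Sg] := eqVneq i j.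
have DC i z : i != j -> D z -> commute (tnth g i) z.
  by move=> ij /shift_coreP[_ cz _ _]; apply: cz.
have Dx z : D z -> D (z ^ x) by case/shift_coreP.
have DxV z : D z -> D (z ^ x^-1) by case/shift_coreP.
pose W : set G := [set a | K a /\ forall z, D z -> commute z a].
have sW : is_subgroup W.
  apply: is_subgroupP.
  - by split=> [|z _]; [apply: subgroup1|apply: commute1].
  - move=> u v [Ku cu] [Kv cv]; split=> [|z Dz]; first exact: subgroupM.
    by apply: commuteM; [apply: cu|apply: cv].
  - move=> u [Ku cu]; split=> [|z Dz]; first exact: subgroupV.
    by apply: commuteV; apply: cu.
have Wg i : i != j -> W (tnth g i).
  move=> ij; split=> [|z Dz]; first exact: Kgi.
  by apply: commute_sym; apply: DC.
have WC a z : W a -> D z -> a ^ z = a.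
  by move=> [_ ca] /ca; rewrite conjgE => <-; rewrite mulKg.
have Wx a : W a -> W (a ^ x).
  (* [a ^ x] centralises [D] because [x] normalises [D]; so [x * d], an element of [K], conjugates
     [a] to the same element as [x]. *)
  move=> Wa; have ca z : D z -> commute z (a ^ x).
    move=> Dz; rewrite /commute -(conjgKV x z) -!conjMg.
    by congr (_ ^ _); apply: (Wa.2); apply: DxV.
  split=> //.
  have <- : a ^ (x * d) = a ^ x.
    by rewrite conjgM conjgE -(ca d Dd) mulKg.
  by apply: subgroupJ => //; case: Wa.
have WxV a : W a -> W (a ^ x^-1).
  move=> Wa; split=> [|z Dz].
    have <- : a ^ (x * d)^-1 = a ^ x^-1.
      by rewrite invgM conjgM (WC a d^-1) //; apply: subgroupV.
    by apply: subgroupJ => //; [case: Wa|apply: subgroupV].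
  rewrite /commute -(conjgK x z) -!conjMg.
  by congr (_ ^ _); apply: (Wa.2); apply: Dx.
have nW u a : W a -> W (a ^ u).
  (* Treating [u] and [u^-1] together makes the set of such [u] closed under inverses. *)
  have: (forall a, W a -> W (a ^ u)) /\ (forall a, W a -> W (a ^ u^-1)).
    move: u; apply: (gind [set u | (forall a, W a -> W (a ^ u)) /\
                                   (forall a, W a -> W (a ^ u^-1))]) => //.
    - apply: is_subgroupP => /= [|u v [u1 u2] [v1 v2]|u [u1 u2]].
      + by split=> b Wb; rewrite ?invg1 conjg1.
      + by split=> b Wb; rewrite ?invgM conjgM; auto.
      + by rewrite invgK.
    - move=> i ij; split=> b Wb; apply: subgroupJ => //; first exact: Wg.
      by apply: subgroupV => //; apply: Wg.
  by case=> + _; apply.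
have sWR v : is_subgroup [set u | W [~ u, v]].
  apply: is_subgroupP => /= [|u u' Wu Wu'|u Wu].
  - by rewrite comm1g; apply: subgroup1.
  - have -> : [~ u * u', v] = [~ u, v] ^ u' * [~ u', v].
      by rewrite !commgEl !conjgE !invgM !mulgA !mulgK.
    by apply: subgroupM => //; apply: nW.
  - have -> : [~ u^-1, v] = ([~ u, v]^-1) ^ u^-1.
      by rewrite !commgEl !conjgE !invgM !invgK !mulgA mulgK.
    by apply: nW; apply: subgroupV.
have WR1 a v : W a -> W [~ a, v].
  move=> Wa; rewrite commgEl; apply: subgroupM => //; first exact: subgroupV.
  exact: nW.
(* Induction over the generators in each argument, exchanged by inverting the commutator, leaves
   [[~ x, x] = 1] and commutators with an element of the normal subgroup [W]. *)
have WR u v : W [~ u, v].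
  move: u; apply: (gind _ (sWR v)) => [|i ij] /=; last by apply: WR1; apply: Wg.
  rewrite -invgR; apply: subgroupV => //.
  move: v; apply: (gind _ (sWR x)) => [|i ij] /=; last by apply: WR1; apply: Wg.
  by rewrite commgg; apply: subgroup1.
have nK u a : K a -> K (a ^ u).
  move=> Ka; rewrite -(mulVKg a (a ^ u)) -commgEl.
  by apply: subgroupM => //; case: (WR a u).
(* [D] is normal in [G], so [K D] is a subgroup; it contains [x] as [x * d] times [d^-1]. *)
have KD u : exists a z, [/\ K a, D z & u = a * z].
  have nD v z : D z -> D (z ^ v).
    have: (forall z, D z -> D (z ^ v)) /\ (forall z, D z -> D (z ^ v^-1)).
      move: v; apply: (gind [set u | (forall a, D a -> D (a ^ u)) /\
                                     (forall a, D a -> D (a ^ u^-1))]) => //.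
      - apply: is_subgroupP => /= [|v v' [u1 u2] [v1 v2]|v [u1 u2]].
        + by split=> b Db; rewrite ?invg1 conjg1.
        + by split=> b Db; rewrite ?invgM conjgM; auto.
        + by rewrite invgK.
      - move=> i ij; split=> b Db; have c := DC i b ij Db.
          by rewrite conjgE -c mulKg.
        by rewrite conjgE invgK mulgA c mulgK.
    by case=> + _; apply.
  move: u; apply: (gind [set u | exists a z, [/\ K a, D z & u = a * z]]).
  - apply: is_subgroupP.
    + by exists 1, 1; rewrite mulg1; split=> //; apply: subgroup1.
    + move=> _ _ [a [z [Ka Dz ->]]] [b [t [Kb Dt ->]]].
      exists (a * b), (z ^ b * t); split; first exact: subgroupM.
        by apply: subgroupM => //; apply: nD.
      by rewrite !mulgA -(mulgA a z) (conjgC z) !mulgA.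
    + move=> _ [a [z [Ka Dz ->]]]; exists a^-1, (z^-1 ^ a^-1); split.
      * exact: subgroupV.
      * by apply: nD; apply: subgroupV.
      * by rewrite invgM [LHS]conjgC.
  - by exists (x * d), d^-1; split=> //; [apply: subgroupV|rewrite mulgK].
  - move=> i ij; exists (tnth g i), 1; split; first exact: Kgi.
      exact: subgroup1.
    by rewrite mulg1.
(* As [K] is normal, [(a * z) ^+ t] lies in the coset [K z ^+ t], and [z] has exponent dividing
   [m]. *)
have KX u : K (u ^+ `|m|%N).
  have [a [z [Ka Dz ->]]] := KD u.
  have Kt t : exists2 b, K b & (a * z) ^+ t = b * z ^+ t.
    elim: t => [|t [b Kb IHt]].
      by exists 1; [apply: subgroup1|rewrite !expg0 mulg1].
    exists (b * a ^ (z ^- t)); first by apply: subgroupM => //; apply: nK.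
    by rewrite !expgSr IHt conjgE !mulgA invgK mulgVK.
  have [b Kb ->] := Kt `|m|%N.
  by rewrite Pm ?mulg1 //; case/shift_coreP: Dz.
have KPX y : P y -> K y.
  move=> /PX[u Gu [v Gv <-]]; apply: subgroupM => //.
  - apply: generated_sub Gu => // _ [a _ [b _ <-]]; by case: (WR a b).
  - by apply: generated_sub Gv => // _ [a _ <-]; apply: subgroup_expgz.
apply: gind => //; rewrite -(mulgK d x); apply: subgroupM => //.
by apply: subgroupV => //; apply: KPX; case/shift_coreP: Dd.
Qed.

(** The orbit count for generating solutions. The last hypothesis keeps the equation for [g_j] true
    after a shift: it is trivial if [k_j = 0], and is given by [pgroup_shift_expg] for a finite
    [p]-group [P]. *)
Lemma card_dvd_solutions (j : 'I_n) (P : set G) (m : int) (k : n.-tuple int) :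
  is_subgroup P ->
  P `<=` set_mulg (commutator_subgroup G) (power_subgroup G m) ->
  (forall y, P y -> y ^+ `|m|%N = 1) ->
  (forall D x d, is_subgroup D -> D `<=` P -> D d ->
     (forall y, D y -> D (y ^ x)) -> x ^+ `|tnth k j|%N = 1 ->
     (x * d) ^+ `|tnth k j|%N = 1) ->
  card_dvd P [set g : n.-tuple G | generated [set` g] = [set: G] /\
    forall i : 'I_n, expgz (tnth g i) (tnth k i) = 1].
Proof.
move=> sP PX Pm Pk; apply: (@card_dvd_twist _ _ j) => // g y [gG gk] Py.
  split; first exact: conj_tuple_generates.
  move=> i; rewrite tnth_mktuple; apply/expgz_eq1.
  by rewrite -conjXg (expgz_eq1 _ _).1 ?conj1g.
split; first by apply: (shift_tuple_generates sP PX Pm).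
move=> i; rewrite tnth_mktuple; have [->|//] := eqVneq i j.
apply/expgz_eq1; apply: (Pk (shift_core j P g)) => //.
- exact: shift_core_subgroup.
- by move=> z /shift_coreP[].
- by move=> z /shift_coreP[].
- exact/expgz_eq1.
Qed.

End Generation.

(** * Prime powers dividing the LCM, and the conclusion *)

Lemma abs_lcm_tuple (n : nat) (k : n.-tuple int) :
  `|lcm_tuple k|%N = \big[lcmn/1%N]_(i < n) `|tnth k i|%N.
Proof. exact: (big_morph absz (id1 := 1%N) (op1 := lcmn)). Qed.

Lemma lcm_tuple_eq0 (n : nat) (k : n.-tuple int) :
  `|lcm_tuple k|%N = 0%N -> exists j, `|tnth k j|%N = 0%N.
Proof.
rewrite abs_lcm_tuple => k0; apply: contrapT => nk.
suff : (0 < \big[lcmn/1%N]_(i < n) `|tnth k i|%N)%N by rewrite k0.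
apply: (big_ind (fun x => 0 < x)%N) => // [a b a_gt0 b_gt0|i _]; first by rewrite lcmn_gt0 a_gt0.
by rewrite lt0n; apply/eqP => ki; apply: nk; exists i.
Qed.

(** The [p]-adic valuation of an LCM is the maximum of the valuations. *)
Lemma pfactor_dvd_lcm_tuple (n : nat) (k : n.-tuple int) (p a : nat) :
  (0 < n)%N -> prime p -> (0 < `|lcm_tuple k|)%N -> p ^ a %| `|lcm_tuple k|%N ->
  exists j, p ^ a %| `|tnth k j|%N.
Proof.
move=> n_gt0 p_pr; rewrite abs_lcm_tuple => m_gt0 pm.
apply: contrapT => nk.
have k_gt0 i : (0 < `|tnth k i|)%N.
  apply: dvdn_gt0 m_gt0 _.
  by apply: (biglcmn_sup i).
(* For [a = 0] any index will do, and [n_gt0] supplies one. *)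
have a_gt0 : (0 < a)%N.
  by rewrite lt0n; apply/eqP => a0; apply: nk; exists (Ordinal n_gt0); rewrite a0.
move: pm; apply/negP.
suff /andP[_] : (0 < \big[lcmn/1%N]_(i < n) `|tnth k i|)%N &&
  ~~ (p ^ a %| \big[lcmn/1%N]_(i < n) `|tnth k i|)%N by [].
apply: (big_ind (fun x => (0 < x)%N && ~~ (p ^ a %| x))).
- by rewrite dvdn1 -(expn0 p) eqn_exp2l ?prime_gt1 // -lt0n.
- move=> x y /andP[x0 px] /andP[y0 py]; rewrite lcmn_gt0 x0 y0 /=.
  move: px py; rewrite !pfactor_dvdn ?lcmn_gt0 ?x0 //.
  by rewrite logn_lcm // leq_max negb_or => -> ->.
- by move=> i _; rewrite k_gt0; apply/negP => pk; apply: nk; exists i.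
Qed.

Lemma set_mulg_power0 (G : groupType) (m : int) : `|m|%N = 0%N ->
  set_mulg (commutator_subgroup G) (power_subgroup G m) = commutator_subgroup G.
Proof.
move=> /eqP; rewrite absz_eq0 => /eqP ->.
apply/seteqP; split => [_ [u Gu [v Gv <-]]|u Gu]; last first.
  exists u => //; exists 1; last by rewrite mulg1.
  by apply: subgroup1; apply: generated_subgroup.
have -> : v = 1; last by rewrite mulg1.
apply: (generated_sub (H := [set 1])) Gv => [|_ [w _ <-]] //.
apply: is_subgroupP => // [x y -> ->|x ->]; first by rewrite mulg1.
by rewrite /= invg1.
Qed.

Theorem mainTheorem2 (G : groupType) (n : nat) (n_gt0 : (0 < n)%N)
    (k : n.-tuple int) :
  let m := lcm_tuple k in
  let X := set_mulg (commutator_subgroup G) (power_subgroup G m) in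
  exists (T : Type) (L : set T),
    is_GCD X m L /\
    card_dvd L
      [set g : n.-tuple G |
        generated [set` g] = [set: G] /\
        forall i : 'I_n, expgz (tnth g i) (tnth k i) = 1%g]%classic.
Proof.
move=> m X; rewrite /is_GCD.
have [m0|m_gt0] := posnP `|m|%N.
  have sX : is_subgroup X.
    by rewrite /X set_mulg_power0 //; apply: generated_subgroup.
  (* Every order divides [0], so [X] belongs to the family and is its LCM. Some [k_j] is [0], so
     [g_j] is under no equation and [P = X] is admissible. *)
  exists G, X; split.
    split=> [A [sA AX _]|U M]; first exact: card_dvd_subgroup.
    apply; split=> //; rewrite m0; exists nat, set0.
    by rewrite setX0 II0; apply: card_eq00.
  have [j kj] := lcm_tuple_eq0 m0.
  by apply: (@card_dvd_solutions _ _ j X m) => //; rewrite ?m0 ?kj.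
have FP A : [/\ is_subgroup A, A `<=` X & card_dvd A `I_(`|m|%N)] ->
    exists2 d, A #= `I_d & d %| `|m|%N.
  move=> [sA AX Am].
  have Im0 : `I_(`|m|%N) !=set0 by exists 0%N.
  have [d Ad] : finite_set A.
    by apply/finite_set_leP; exists `|m|%N; apply: card_dvd_le.
  by exists d => //; apply/card_dvd_II; apply: card_dvd_eql Ad Am.
have [l lP] := bounded_card_lcm m_gt0 FP.
(* By the universal property each [A] is treated alone. Its order is split into prime powers, each
   the order of a Sylow subgroup [P] of [A] and a divisor of some [k_j]. *)
exists nat, `I_l; split=> //; apply: lP.2 => A FA.
have [sA AX _] := FA; have [d Ad dm] := FP A FA.
apply: (@card_dvd_eql _ _ _ `I_d); first by rewrite card_eq_sym.
apply: card_dvd_II_primes => [|p p_pr]; first exact: dvdn_gt0 dm.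
have [P [sP PA oP]] := finite_subgroup_sylow p sA Ad.
have pm : p ^ logn p d %| `|m|%N := dvdn_trans (pfactor_dvdnn p d) dm.
have [j pj] := pfactor_dvd_lcm_tuple n_gt0 p_pr m_gt0 pm.
apply: (card_dvd_eql oP); apply: (@card_dvd_solutions _ _ j P m) => //.
- by move=> y /PA /AX.
- move=> y /(finite_subgroup_expg sP oP) yp.
  by case/dvdnP: pm => c ->; rewrite mulnC expgnA yp expg1n.
- by move=> D x y sD DP Dy Dx xk; exact: (pgroup_shift_expg p_pr oP pj sP sD DP Dy Dx xk).
Qed.
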